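(* Let $\mathcal{P}$ be a PTRS with only finitely many rules, and suppose the signature $\Sigma$ over which terms are built contains a function symbol of arity at least $2$. Then $\mathtt{PAST}(\xrightarrow{\mathbf{f}}_{\mathcal{P}})$ holds if and only if $\mathtt{SAST}(\xrightarrow{\mathbf{f}}_{\mathcal{P}})$ holds.
   Context: Terms $\mathcal{T}$ over the signature $\Sigma$ and countable variables. $\mathrm{FDist}(A)$: finite multisets of pairs $(p:a)$, $0<p\le1$, probabilities summing to 1. A PTRS is a countable set $\mathcal{P}$ of rules $\ell\to\mu$, $\ell$ non-variable, $\mu\in\mathrm{FDist}(\mathcal{T})$, variables of terms in $\mu$ among those of $\ell$. $t\xrightarrow{\mathbf{f}}_{\mathcal{P}}\{p_1:t_1,\dots,p_k:t_k\}$ iff $t|_\pi=\ell\sigma$, $t_j=t[r_j\sigma]_\pi$ for a position $\pi$, rule $\ell\to\{p_1:r_1,\dots,p_k:r_k\}$, substitution $\sigma$; normal forms admit no step. Lifting $\rightrightarrows$: smallest relation on multi-distributions with $\{1:t\}\rightrightarrows\{1:t\}$ for normal forms, $\{1:t\}\rightrightarrows\mu$ if $t\xrightarrow{\mathbf{f}}_{\mathcal{P}}\mu$, closed under $\bigcup_jp_j\cdot\mu_j\rightrightarrows\bigcup_jp_j\cdot\nu_j$ ($\sum p_j=1$). $|\mu|$: probability of normal forms; $\mathrm{edl}((\mu_n))=\sum_n(1-|\mu_n|)$. $\mathtt{PAST}$: every infinite $\rightrightarrows$-sequence with $\mu_0=\{1:t\}$ has finite $\mathrm{edl}$. $\mathtt{SAST}$: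 for every term $t$ the supremum of $\mathrm{edl}$ over all infinite $\rightrightarrows$-sequences with $\mu_0=\{1:t\}$ is finite. *)

(* Defs.v *)
From HB Require Import structures.
From mathcomp Require Import all_boot all_order all_algebra.
From mathcomp Require Import finmap multiset.
From mathcomp Require Import all_classical all_reals all_analysis.
Set Implicit Arguments.
Unset Strict Implicit.
Unset Printing Implicit Defensive.
Import Order.TTheory GRing.Theory Num.Theory.
Local Open Scope classical_set_scope.
Local Open Scope ring_scope.

Notation multidist R A := {mset (R * A)%type}%mset.

Section MultiDistributions.
Variable R : realType.

Definition is_fdist (A : choiceType) (mu : multidist R A) : Prop :=
  (forall x : (R * A)%type, x \in mu -> 0 < x.1 <= 1)
  /\ \sum_(x <- mu) x.1 = 1.

Definition mset_map (A B : choiceType) (f : A -> B) (mu : {mset A}%mset) :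
  {mset B}%mset := seq_mset [seq f x | x <- mu].

Definition mdist_scale (A : choiceType) (p : R) (mu : multidist R A) :
    multidist R A :=
  mset_map (fun x : (R * A)%type => (p * x.1, x.2)) mu.

Definition mdirac (A : choiceType) (a : A) : multidist R A :=
  [mset (1, a)]%mset.

End MultiDistributions.

Section ProbabilisticARS.
Variables (R : realType) (A : choiceType).
Variable red : A -> multidist R A -> Prop.

Definition normal_form (a : A) : Prop := ~ exists mu, red a mu.

(* Although stated on arbitrary multisets, this only relates multi-distributions
   when red does; see mlift_fdist and rewrite_full_fdist. *)
Inductive mlift :
    multidist R A -> multidist R A -> Prop :=
| mlift_nf a : normal_form a -> mlift (mdirac R a) (mdirac R a)
| mlift_red a mu : red a mu -> mlift (mdirac R a) mu
| mlift_union k (p : 'I_k -> R) (mu nu : 'I_k -> multidist R A) :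
    (forall j, 0 < p j <= 1) -> \sum_(j < k) p j = 1 ->
    (forall j, mlift (mu j) (nu j)) ->
    mlift (\big[@msetD _/mset0]_(j < k) mdist_scale (p j) (mu j))
         (\big[@msetD _/mset0]_(j < k) mdist_scale (p j) (nu j)).

Definition nf_mass (mu : multidist R A) : R :=
  \sum_(x <- mu | `[< normal_form x.2 >]) x.1.

Definition mlift_seq_from (a : A) : set (nat -> multidist R A) :=
  [set mu | mu 0%N = mdirac R a /\ forall n, mlift (mu n) (mu n.+1)].

Definition edl (mu : nat -> multidist R A) : \bar R :=
  (\sum_(0 <= n <oo) (1 - nf_mass (mu n))%:E)%E.

Definition PAST : Prop :=
  forall a mu, mlift_seq_from a mu -> (edl mu < +oo)%E.

Definition SAST : Prop :=
  forall a, (ereal_sup [set edl mu | mu in mlift_seq_from a] < +oo)%E.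

End ProbabilisticARS.

Record signature := Signature {
  symbol : Type;
  arity : symbol -> nat }.

Inductive term (S : signature) (V : countType) : Type :=
| Var of V
| App (f : symbol S) of ('I_(arity f) -> term S V).

Arguments Var {S V} _.
Arguments App {S V} f _.

HB.instance Definition _ (S : signature) (V : countType) :=
  gen_eqMixin (term S V).
HB.instance Definition _ (S : signature) (V : countType) :=
  gen_choiceMixin (term S V).

Section Terms.
Variables (S : signature) (V : countType).

Definition is_var (t : term S V) : bool := if t is Var _ then true else false.

Fixpoint vars (t : term S V) : set V :=
  match t with
  | Var x => [set x]
  | App f a => \bigcup_(i in [set: 'I_(arity f)]) vars (a i)
  end.

Fixpoint subst (s : V -> term S V) (t : term S V) : term S V :=
  match t with
  | Var x => s x
  | App f a => App f (fun i => subst s (a i))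
  end.

(* Positions are words over argument indices, counted from 0; None signals a
   position outside of t. *)
Fixpoint subterm_at (t : term S V) (pi : seq nat) : option (term S V) :=
  match pi, t with
  | [::], _ => Some t
  | i :: pi', App f a =>
      if (insub i : option 'I_(arity f)) is Some j
      then subterm_at (a j) pi' else None
  | _ :: _, Var _ => None
  end.

(* Leaves t unchanged if pi is not a position of t. *)
Fixpoint replace_at (t : term S V) (pi : seq nat) (u : term S V) : term S V :=
  match pi, t with
  | [::], _ => u
  | i :: pi', App f a =>
      App f (fun j : 'I_(arity f) =>
        if val j == i then replace_at (a j) pi' u else a j)
  | _ :: _, Var _ => t
  end.

End Terms.

Section PTRS.
Variables (R : realType) (S : signature) (V : countType).

Definition rule := (term S V * multidist R (term S V))%type.

Definition is_rule (r : rule) : Prop :=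
  [/\ ~~ is_var r.1,
      is_fdist r.2
    & forall x : (R * term S V)%type, x \in r.2 -> vars x.2 `<=` vars r.1].

Record ptrs := Ptrs {
  rules :> set rule;
  rules_countable : countable rules;
  rules_wf : forall r, rules r -> is_rule r }.

Definition rewrite_full (P : ptrs)
    (t : term S V) (nu : multidist R (term S V)) : Prop :=
  exists (r : rule) (pi : seq nat) (s : V -> term S V),
    [/\ rules P r,
        subterm_at t pi = Some (subst s r.1)
      & nu = mset_map (fun x : (R * term S V)%type =>
                         (x.1, replace_at t pi (subst s x.2))) r.2].

End PTRS.

Lemma enum_msetD_perm (K : choiceType) (B C : {mset K}%mset) :
  perm_eq (B `+` C)%mset (enum_mset B ++ C).
Proof.
apply/allP => x _ /=; rewrite count_cat.
by rewrite !count_mem_mset msetE2.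
Qed.

Lemma is_fdist_union (R : realType) (A : choiceType) k (p : 'I_k -> R)
    (mu : 'I_k -> multidist R A) :
  (forall j, 0 < p j <= 1) -> \sum_(j < k) p j = 1 ->
  (forall j, is_fdist (mu j)) ->
  is_fdist (\big[@msetD _/mset0]_(j < k) mdist_scale (p j) (mu j)).
Proof.
move=> p01 p1 mufd.
have memS j x : x \in mdist_scale (p j) (mu j) -> 0 < x.1 <= 1.
  rewrite /mdist_scale /mset_map (perm_mem (perm_eq_seq_mset _)).
  case/mapP=> y ymu -> /=; have /andP[y0 y1] := (mufd j).1 y ymu.
  have /andP[p0 p1'] := p01 j.
  by rewrite mulr_gt0 //= mulr_ile1 // ltW.
split.
  move=> x; elim/big_ind : _ => [|B C IHB IHC|j _].
  - by rewrite in_mset0.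
  - by rewrite in_msetD => /orP[/IHB|/IHC].
  - exact: memS.
rewrite -[RHS]p1.
apply: (big_ind2 (fun (B : multidist R A) (b : R) => \sum_(x <- B) x.1 = b)) => [|B b C c <- <-|j _].
- by rewrite enum_mset0 big_nil.
- by rewrite (perm_big _ (enum_msetD_perm _ _)) /= big_cat.
- rewrite /mdist_scale /mset_map (perm_big _ (perm_eq_seq_mset _)) /= big_map /=.
  by rewrite -mulr_sumr (mufd j).2 mulr1.
Qed.

Lemma mlift_fdist (R : realType) (A : choiceType)
    (red : A -> multidist R A -> Prop) mu nu :
  (forall a mu, red a mu -> is_fdist mu) ->
  mlift red mu nu -> is_fdist mu /\ is_fdist nu.
Proof.
move=> redP; have dfd (a : A) : is_fdist (mdirac R a).
  split; first by move=> x; rewrite in_msetn /= => /eqP -> /=; rewrite ltr01 lexx.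
  by rewrite enum_msetn /= big_seq1.
elim=> [a _|a mu' /redP|k p mu' nu' p01 p1 _ IH] //.
by split; apply: is_fdist_union => // j; case: (IH j).
Qed.

Lemma rewrite_full_fdist (R : realType) S V (P : ptrs R S V) t nu :
  rewrite_full P t nu -> is_fdist nu.
Proof.
case=> r [pi [s [/rules_wf[_ [r01 r1] _] _ ->]]]; rewrite /mset_map; split.
  move=> x; rewrite (perm_mem (perm_eq_seq_mset _)) => /mapP[y /r01 + ->] //.
by rewrite (perm_big _ (perm_eq_seq_mset _)) /= big_map.
Qed.

(* Main.v *)
Require Import Defs.
From mathcomp Require Import all_boot all_order all_algebra.
From mathcomp Require Import finmap multiset.
From mathcomp Require Import all_classical all_reals all_analysis.
Set Implicit Arguments.
Unset Strict Implicit.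
Unset Printing Implicit Defensive.
Import Order.TTheory GRing.Theory Num.Theory.
Local Open Scope classical_set_scope.
Local Open Scope ring_scope.

(** Reduction is finitely branching, so for each k the maximal expected number of
steps within k rounds, [opt_steps k], is attained by a greedy strategy. If SAST
fails, some term t has unbounded [opt_steps k t]; finite branching then gives a
step from t with an unbounded outcome, hence an infinite path t = t_0, t_1, ... of
unbounded terms, where t_(n+1) is reached from t_n with probability p_n. Start
from f(t,t,...) with f at least binary and follow the path in the first argument.
Whenever the path is left, at step n with total probability
q_n = p_0 ... p_(n-1) (1 - p_n) > 0, play greedily in the untouched second
argument t for an expected number of at least 1/q_n steps. If p_n < 1 infinitely
often, each such n contributes at least 1 to the expected derivation length;
otherwise the path keeps a positive probability forever. Both contradict PAST. *)

(** * A real recursion whose values must diverge *)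

(* [L n m] is the expected number of steps within n rounds from the m-th point of
   the path, [h m] the value of leaving the path there, available once [K m]
   rounds remain. *)
Lemma escape_recursion_unbounded (R : realType) (p h : nat -> R) (K : nat -> nat)
    (L : nat -> nat -> R) :
  (forall m, 0 < p m <= 1) -> (forall n m, 0 <= L n m) ->
  (forall m n, (K m <= n)%N ->
    1 + (p m * L n m.+1 + (1 - p m) * h m) <= L n.+1 m) ->
  (forall m, p m < 1 -> 1 <= \prod_(i < m) p i * ((1 - p m) * h m)) ->
  forall B, exists n, B < L n 0%N.
Proof.
move=> p01 L0 Lrec hbig; pose w m := \prod_(i < m) p i.
(* Gain guaranteed by the first m path points: [w i] for the step at point i, plus 1 if the path can
   be left there. *)
pose a m := \sum_(i < m) (w i + (p i < 1)%R%:R).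
have w0 m : 0 < w m by apply: prodr_gt0 => i _; case/andP: (p01 i).
have wS m : w m.+1 = w m * p m by rewrite /w big_ord_recr.
have aS m : a m.+1 = a m + (w m + (p m < 1)%R%:R) by rewrite /a big_ord_recr.
(* Unrolls the recursion m times; N has to exceed every [K i] met on the way. *)
have La m : exists N, forall n, (N <= n)%N -> a m + w m * L n m <= L (n + m)%N 0%N.
  elim: m => [|m [N IH]].
    by exists 0%N => n _; rewrite /a /w !big_ord0 add0r mul1r addn0.
  exists (maxn N (K m)) => n; rewrite geq_max => /andP[Nn Kn].
  rewrite addnS -addSn; apply: le_trans (IH n.+1 (leqW Nn)).
  rewrite aS -addrA lerD2l wS; have := Lrec m n Kn.
  rewrite -(ler_pM2l (w0 m)); apply: le_trans; rewrite mulrDr mulr1 -addrA lerD2l.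
  rewrite mulrDr mulrA [leRHS]addrC lerD2r.
  have [/hbig //|p1] := ltP (p m) 1.
  suff -> : p m = 1 by rewrite subrr mul0r mulr0.
  by apply/eqP; rewrite eq_le p1; case/andP: (p01 m) => _ ->.
have a_homo : {homo a : m n / (m <= n)%N >-> m <= n}.
  apply: homo_leq => [//|y x z|n]; first exact: le_trans.
  by rewrite aS lerDl addr_ge0 // ltW.
suff a_ub B : exists m, B < a m.
  move=> B; have [m Bm] := a_ub B; have [N NP] := La m; exists (N + m)%N.
  apply: lt_le_trans Bm (le_trans _ (NP _ (leqnn N))).
  by rewrite lerDl mulr_ge0 // ltW.
(* Either [w] is constant from N on and [a] grows at least linearly with slope [w N], or infinitely
   many indices each add 1 to [a]. *)
have [[N p1]|ninf] := pselect (exists N, forall i, (N <= i)%N -> p i = 1).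
  have wN j : w (N + j)%N = w N.
    by elim: j => [|j IH]; rewrite ?addn0 // addnS wS IH p1 ?mulr1 // leq_addr.
  have aN j : w N *+ j <= a (N + j)%N.
    elim: j => [|j IH].
      by rewrite mulr0n /a sumr_ge0 // => i _; rewrite addr_ge0 // ltW.
    rewrite addnS aS mulrS addrC wN; apply: lerD => //.
    by rewrite lerDl.
  have Bj := archi_boundP (normr_ge0 (B / w N)).
  exists (N + Num.bound `|B / w N|)%N; apply: lt_le_trans (aN _).
  rewrite -mulr_natr mulrC -ltr_pdivrMr //.
  exact: le_lt_trans (ler_norm _) Bj.
have ak k : exists m, k%:R <= a m.
  elim: k => [|k [m km]]; first by exists 0%N; rewrite /a big_ord0.
  have [i [mi pi]] : exists i, (m <= i)%N /\ p i < 1.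
    apply: contrapT => ni; apply: ninf; exists m => i mi.
    apply/eqP; rewrite eq_le; case/andP: (p01 i) => _ ->; rewrite leNgt.
    by apply/negP => pi; apply: ni; exists i.
  exists i.+1; rewrite aS pi /= -[k.+1%:R]natr1 (le_trans (lerD km (lexx _))) //.
  by apply: lerD; [exact: a_homo|rewrite lerDr ltW].
have [m Bm] := ak (Num.bound `|B|).
exists m; apply: lt_le_trans Bm; apply: le_lt_trans (ler_norm _) _.
exact: archi_boundP.
Qed.

(** * Expectations and images of weighted lists *)

Section Expectation.
Variable R : realType.

Definition expect (Q : Type) (g : Q -> R) (s : seq (R * Q)) : R :=
  \sum_(x <- s) x.1 * g x.2.

(** Weighted lists over [Q] keep apart strategy states with the same image; only the image is a
    multi-distribution. *)
Definition push (Q : Type) (A : choiceType) (f : Q -> A) (s : seq (R * Q)) :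
  multidist R A := seq_mset [seq (x.1, f x.2) | x <- s].

Lemma le_expect (Q : eqType) (g g' : Q -> R) (s : seq (R * Q)) :
  (forall x, x \in s -> 0 <= x.1) -> (forall x, x \in s -> g x.2 <= g' x.2) ->
  expect g s <= expect g' s.
Proof.
move=> s0 gg'; rewrite /expect !big_seq; apply: ler_sum => x xs.
by rewrite ler_wpM2l ?s0 ?gg'.
Qed.

Lemma expect_ge0 (Q : eqType) (g : Q -> R) (s : seq (R * Q)) :
  (forall x, x \in s -> 0 <= x.1) -> (forall q, 0 <= g q) -> 0 <= expect g s.
Proof.
move=> s0 g0; rewrite /expect big_seq; apply: sumr_ge0 => x xs.
by rewrite mulr_ge0 ?s0.
Qed.

Lemma expect_push (Q : Type) (A : choiceType) (f : Q -> A) (g : A -> R) s :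
  expect g (push f s) = expect (g \o f) s.
Proof. by rewrite /expect (perm_big _ (perm_eq_seq_mset _)) /= big_map. Qed.

Lemma expect_mdirac (A : choiceType) (g : A -> R) a :
  expect g (mdirac R a) = g a.
Proof. by rewrite /expect enum_msetn /= big_seq1 mul1r. Qed.

Lemma expect_union (A : choiceType) (g : A -> R) k (p : 'I_k -> R)
    (mu : 'I_k -> multidist R A) :
  expect g (\big[@msetD _/mset0]_(j < k) mdist_scale (p j) (mu j))%mset =
  \sum_(j < k) p j * expect g (mu j).
Proof.
apply: (big_ind2 (fun (B : multidist R A) b => expect g B = b))
  => [|B b C c <- <-|j _].
- by rewrite /expect enum_mset0 big_nil.
- by rewrite /expect (perm_big _ (enum_msetD_perm _ _)) /= big_cat.
- rewrite /mdist_scale /mset_map /expect (perm_big _ (perm_eq_seq_mset _)) /=.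
  by rewrite big_map mulr_sumr; apply: eq_bigr => x _ /=; rewrite mulrA.
Qed.

Lemma seq_mset_cat (K : choiceType) (s1 s2 : seq K) :
  seq_mset (s1 ++ s2) = (seq_mset s1 `+` seq_mset s2)%mset.
Proof. by apply/msetP => x; rewrite msetE2 !mset_seqE count_cat. Qed.

Lemma mset_map_seq_mset (K L : choiceType) (f : K -> L) (s : seq K) :
  mset_map f (seq_mset s) = seq_mset [seq f x | x <- s].
Proof. by apply/eq_seq_msetP/perm_map/perm_eq_seq_mset. Qed.

Lemma push_flatten (Q : Type) (A : choiceType) (f : Q -> A) I (r : seq I)
    (F : I -> seq (R * Q)) :
  push f (flatten [seq F i | i <- r]) =
  (\big[@msetD _/mset0]_(i <- r) push f (F i))%mset.
Proof.
elim: r => [|i r IH].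
  by rewrite big_nil; apply/msetP => x; rewrite mset_seqE mset0E.
by rewrite big_cons -IH /= /push map_cat seq_mset_cat.
Qed.

Lemma push_scale (Q : Type) (A : choiceType) (f : Q -> A) p (s : seq (R * Q)) :
  push f [seq (p * y.1, y.2) | y <- s] = mdist_scale p (push f s).
Proof. by rewrite /push /mdist_scale mset_map_seq_mset -!map_comp. Qed.

Lemma push1 (Q : Type) (A : choiceType) (f : Q -> A) q :
  push f [:: (1, q)] = mdirac R (f q).
Proof.
apply/msetP => x; rewrite mset_seqE /= addn0 /mdirac.
by rewrite msetnE eq_sym; case: eqP.
Qed.

Lemma push_seq_mset (K A : choiceType) (f : K -> A) (s : seq (R * K)) :
  push f (seq_mset s) = push f s.
Proof. by apply/eq_seq_msetP/perm_map/perm_eq_seq_mset. Qed.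

Lemma push_prob (Q : eqType) (A : choiceType) (f : Q -> A) (s : seq (R * Q)) :
  is_fdist (push f s) -> forall x, x \in s -> 0 < x.1 <= 1.
Proof.
move=> [+ _] x xs => /(_ (x.1, f x.2)); apply.
rewrite (perm_mem (perm_eq_seq_mset _)).
by apply/mapP; exists x.
Qed.

Lemma sum_push (Q : Type) (A : choiceType) (f : Q -> A) (s : seq (R * Q)) :
  \sum_(x <- push f s) x.1 = \sum_(x <- s) x.1.
Proof. by rewrite (perm_big _ (perm_eq_seq_mset _)) big_map. Qed.

Lemma seq_argmax (T : eqType) (F : T -> R) (s : seq T) : s != [::] ->
  exists2 x, x \in s & forall y, y \in s -> F y <= F x.
Proof.
elim: s => // x [|y t] IH _.
  by exists x; rewrite ?inE // => z; rewrite inE => /eqP ->.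
have [//|z zt zP] := IH.
have [xz|zx] := leP (F x) (F z).
  by exists z; [rewrite inE zt orbT|move=> w; rewrite inE => /predU1P[->|/zP]].
exists x; rewrite ?inE ?eqxx // => w; rewrite inE => /predU1P[->//|/zP wz].
exact: le_trans wz (ltW zx).
Qed.

End Expectation.

(** * Derivation lengths and strategies for an abstract relation *)

Section Derivations.
Variables (R : realType) (A : choiceType) (red : A -> multidist R A -> Prop).
Hypothesis red_fdist : forall a mu, red a mu -> is_fdist mu.

(** Its expectation under a multi-distribution is the summand of [edl]. *)
Definition live (a : A) : R := (~~ `[< normal_form red a >])%:R.

Lemma live_ge0 a : 0 <= live a. Proof. exact: ler0n. Qed.

Lemma live_red a mu : red a mu -> live a = 1.
Proof.
by move=> amu; rewrite /live; case: asboolP => // nf; case: nf; exists mu.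
Qed.

Lemma live_nf a : normal_form red a -> live a = 0.
Proof. by move=> nf; rewrite /live; case: asboolP. Qed.

Lemma sub_nf_mass mu : is_fdist mu -> 1 - nf_mass red mu = expect live mu.
Proof.
move=> [_ <-]; rewrite /nf_mass (bigID (fun x => `[< normal_form red x.2 >])) /=.
rewrite addrAC subrr add0r /expect big_mkcond /=; apply: eq_bigr => x _.
by rewrite /live; case: asboolP; rewrite ?mulr0 ?mulr1.
Qed.

Lemma mlift_seq_fdist a mu :
  mlift_seq_from red a mu -> forall n, is_fdist (mu n).
Proof. by move=> [_ + n] => /(_ n) /(mlift_fdist red_fdist)[]. Qed.

Lemma edl_term_ge0 a mu : mlift_seq_from red a mu ->
  forall n, (0 <= (1 - nf_mass red (mu n))%:E)%E.
Proof.
move=> amu n; have fd := mlift_seq_fdist amu n.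
rewrite lee_fin sub_nf_mass //; apply: expect_ge0 => [x xmu|]; last exact: live_ge0.
by have /andP[/ltW] := fd.1 x xmu.
Qed.

Lemma edl_le a mu (B : R) : mlift_seq_from red a mu ->
  (forall n, \sum_(0 <= i < n) expect live (mu i) <= B) -> (edl red mu <= B%:E)%E.
Proof.
move=> amu muB; apply: lime_le.
  by apply: is_cvg_nneseries => n _ _; exact: edl_term_ge0 amu n.
apply: nearW => n /=; rewrite sumEFin lee_fin.
rewrite (eq_bigr (fun i => expect live (mu i))) // => i _.
by rewrite sub_nf_mass //; exact: mlift_seq_fdist amu i.
Qed.

Lemma edl_ge a mu n : mlift_seq_from red a mu ->
  ((\sum_(0 <= i < n) expect live (mu i))%:E <= edl red mu)%E.
Proof.
move=> amu; rewrite -sumEFin.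
rewrite (eq_bigr (fun i => (1 - nf_mass red (mu i))%:E)) => [|i _]; last first.
  by rewrite sub_nf_mass //; exact: mlift_seq_fdist amu i.
by apply: nneseries_lim_ge => i _ _; exact: edl_term_ge0 amu i.
Qed.

(* A strategy with memory: the states Q refine the terms [tm q], and [step] moves
   deterministically between finite distributions on states. *)
Section Policy.
Variables (Q : eqType) (tm : Q -> A) (step : Q -> seq (R * Q)).
Hypothesis stepP : forall q, mlift red (mdirac R (tm q)) (push tm (step q)).

Definition bind_step (s : seq (R * Q)) : seq (R * Q) :=
  flatten [seq [seq (x.1 * y.1, y.2) | y <- step x.2] | x <- s].

Fixpoint steps_from (n : nat) (q : Q) : R :=
  if n is n'.+1 then live (tm q) + expect (steps_from n') (step q) else 0.

Lemma step_fdist q : is_fdist (push tm (step q)).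
Proof. by case: (mlift_fdist red_fdist (stepP q)). Qed.

Lemma step_ge0 q x : x \in step q -> 0 <= x.1.
Proof. by move=> /(push_prob (step_fdist q)) /andP[/ltW]. Qed.

(** Splitting the list into weighted Dirac masses lets [mlift_union] apply with one component per
    entry. *)
Lemma mlift_bind_step s : is_fdist (push tm s) ->
  mlift red (push tm s) (push tm (bind_step s)).
Proof.
move=> sfd; have -> : push tm s =
    (\big[@msetD _/mset0]_(x <- s) mdist_scale x.1 (mdirac R (tm x.2)))%mset.
  rewrite -[in LHS](flatten_seq1 s) push_flatten; apply: eq_bigr => x _.
  by rewrite -push1 -push_scale /= mulr1 -surjective_pairing.
rewrite /bind_step push_flatten.
under [X in mlift _ _ X]eq_bigr do rewrite push_scale.
rewrite !(big_tnth _ _ s); apply: mlift_union => [j||j]; last exact: stepP.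
  by apply: (push_prob sfd); exact: mem_tnth.
rewrite -(big_tnth _ _ s predT (fun x => x.1)) /=.
by rewrite -(sum_push tm s) sfd.2.
Qed.

Lemma policy_seq q :
  mlift_seq_from red (tm q) (fun n => push tm (iter n bind_step [:: (1, q)])).
Proof.
have dfd : is_fdist (push tm [:: (1 : R, q)]).
  by rewrite push1; case: (mlift_fdist red_fdist (stepP q)).
split=> [|n] /=; first exact: push1.
apply: mlift_bind_step; elim: n => [//|n IH] /=.
by case: (mlift_fdist red_fdist (mlift_bind_step IH)).
Qed.

Lemma expect_bind_step g s :
  expect g (bind_step s) = expect (fun q => expect g (step q)) s.
Proof.
rewrite /expect /bind_step big_flatten /= big_map; apply: eq_bigr => x _.
by rewrite big_map mulr_sumr; apply: eq_bigr => y _ /=; rewrite mulrA.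
Qed.

(** Peeling off the first round matches the forward iteration of [bind_step] with the first-step
    recursion of [steps_from]. *)
Lemma sum_live_policy n s :
  \sum_(0 <= i < n) expect live (push tm (iter i bind_step s)) =
  expect (steps_from n) s.
Proof.
elim: n s => [|n IH] s.
  by rewrite big_geq // /expect big1 // => x _; rewrite mulr0.
rewrite big_nat_recl //=; under eq_bigr do rewrite -iterS iterSr.
rewrite IH expect_bind_step expect_push /expect -big_split /=.
by apply: eq_bigr => x _; rewrite mulrDr.
Qed.

Lemma steps_from_ge0 n q : 0 <= steps_from n q.
Proof.
elim: n q => //= n IH q; rewrite addr_ge0 ?live_ge0 //.
by apply: expect_ge0 => //; exact: step_ge0.
Qed.

Lemma steps_from_homo q : {homo steps_from^~ q : m n / (m <= n)%N >-> m <= n}.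
Proof.
apply: homo_leq => [//|y x z|n]; first exact: le_trans.
elim: n q => [|n IH] q; first exact: steps_from_ge0.
by rewrite /= lerD2l; apply: le_expect => x xq; [exact: step_ge0 xq|exact: IH].
Qed.

Lemma PAST_policy_bounded q : PAST red -> exists B, forall n, steps_from n q <= B.
Proof.
move=> /(_ _ _ (policy_seq q)) edl_fin.
exists (fine (edl red (fun n => push tm (iter n bind_step [:: (1, q)])))) => n.
have := edl_ge n (policy_seq q); rewrite sum_live_policy.
rewrite {1}/expect big_seq1 mul1r.
by move: edl_fin; case: (edl _ _) => [r| |] //= _; rewrite lee_fin.
Qed.

End Policy.

(** * Greedy values and unbounded elements *)

Section FiniteBranching.
Hypothesis red_finite : forall a, finite_set (red a).

(** Finite branching provides a maximiser at every reducible element; the default [mset0] occurs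
    only at normal forms. *)
Definition best (g : A -> R) (a : A) : multidist R A :=
  xget mset0
    [set mu | red a mu /\ forall nu, red a nu -> expect g nu <= expect g mu].

Lemma bestP g a : ~ normal_form red a ->
  red a (best g a) /\ forall nu, red a nu -> expect g nu <= expect g (best g a).
Proof.
move=> /contrapT[mu0 amu0]; rewrite /best; case: xgetP => [mu _ //|none].
have /finite_seqP[s sE] := red_finite a.
have redE nu : red a nu <-> nu \in s by rewrite sE.
have [|mu mus muP] := @seq_argmax R _ (fun mu : multidist R A => expect g mu) s.
  by move/redE: amu0; case: (s).
by case: (none mu); split=> [|nu /redE/muP //]; exact/redE.
Qed.

Fixpoint opt_steps (k : nat) (a : A) : R :=
  if k is k'.+1 then
    if `[< normal_form red a >] then 0
    else 1 + expect (opt_steps k') (best (opt_steps k') a)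
  else 0.

Lemma opt_steps_nf k a : normal_form red a -> opt_steps k a = 0.
Proof. by case: k => //= k nf; case: asboolP. Qed.

Lemma red_ge0 a mu : red a mu -> forall x, x \in mu -> 0 <= x.1.
Proof. by move=> /red_fdist[mu0 _] x /mu0 /andP[/ltW]. Qed.

Lemma opt_steps_ge0 k a : 0 <= opt_steps k a.
Proof.
elim: k a => //= k IH a; case: asboolP => // /(bestP (opt_steps k))[abest _].
by rewrite addr_ge0 //; apply: expect_ge0 => //; exact: red_ge0 abest.
Qed.

Lemma opt_steps_red k a mu : red a mu -> 1 + expect (opt_steps k) mu <= opt_steps k.+1 a.
Proof.
move=> amu /=; case: asboolP => [[]|nnf]; first by exists mu.
by rewrite lerD2l; apply: (bestP _ nnf).2.
Qed.

(** Bellman inequality: both sides are linear in the multi-distributions, so the bound for a single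
    step passes to weighted unions. *)
Lemma mlift_opt_steps k mu nu : mlift red mu nu ->
  expect live mu + expect (opt_steps k) nu <= expect (opt_steps k.+1) mu.
Proof.
elim=> [a nf|a mu' amu|m p mu' nu' p01 _ _ IH].
- by rewrite !expect_mdirac live_nf // !opt_steps_nf // addr0.
- by rewrite !expect_mdirac (live_red amu); exact: opt_steps_red.
rewrite !expect_union -big_split /=; apply: ler_sum => j _.
by rewrite -mulrDr ler_wpM2l //; have /andP[/ltW] := p01 j.
Qed.

Lemma sum_live_le_opt_steps n mu : (forall i, mlift red (mu i) (mu i.+1)) ->
  \sum_(0 <= i < n) expect live (mu i) <= expect (opt_steps n) (mu 0%N).
Proof.
elim: n mu => [|n IH] mu muP.
  by rewrite big_geq // /expect big1 // => x _; rewrite mulr0.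
rewrite big_nat_recl //; apply: le_trans (mlift_opt_steps n (muP 0%N)).
by rewrite lerD2l; apply: (IH (fun i => mu i.+1)).
Qed.

Definition unbounded a := forall B, exists k, B < opt_steps k a.

Lemma not_unbounded a : ~ unbounded a -> exists B, forall k, opt_steps k a <= B.
Proof.
move=> nub; apply: contrapT => nB; apply: nub => B; apply: contrapT => nk.
apply: nB; exists B => k; rewrite leNgt; apply/negP => Bk; apply: nk; by exists k.
Qed.

Lemma not_SAST_unbounded : ~ SAST red -> exists a, unbounded a.
Proof.
move=> nS; apply: contrapT => nub; apply: nS => a.
have [|B aB] := @not_unbounded a; first by move=> ub; apply: nub; exists a.
apply: (@le_lt_trans _ _ B%:E); last exact: ltry.
apply: ge_ereal_sup => _ [mu amu <-]; apply: (edl_le amu) => n.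
apply: le_trans (sum_live_le_opt_steps n amu.2) _.
by rewrite amu.1 expect_mdirac.
Qed.

(** If every element of every reduct had a bound [B b], then 1 plus the largest expectation of [B]
    over the finitely many reducts would bound [opt_steps k a] for all k. *)
Lemma unbounded_red a : unbounded a ->
  exists mu x, [/\ red a mu, x \in mu & unbounded x.2].
Proof.
move=> ub; apply: contrapT => nx.
have /choice[B BP] : forall b, exists B : R,
    ~ unbounded b -> forall k, opt_steps k b <= B.
  move=> b.
  have [u|/not_unbounded[B bB]] := pselect (unbounded b); last by exists B.
  by exists 0.
have nnf : ~ normal_form red a.
  by move=> nf; have [k] := ub 0; rewrite opt_steps_nf // ltxx.
have [bestB maxB] := bestP B nnf.
have B_ge0 : 0 <= 1 + expect B (best B a).
  rewrite addr_ge0 //; apply: (@le_trans _ _ (expect (opt_steps 0) (best B a))).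
    by rewrite /expect big1 // => x _; rewrite mulr0.
  apply: le_expect => [|x xb]; first exact: red_ge0 bestB.
  by apply: BP => ux; apply: nx; exists (best B a), x.
have [[|k]] := ub (1 + expect B (best B a)); first by rewrite /= ltNge B_ge0.
rewrite /=; case: asboolP => // _; rewrite ltNge lerD2l => /negP; apply.
have [bestk _] := bestP (opt_steps k) nnf.
(* The greedy reduct varies with k; comparison with the reduct maximising [expect B] makes the bound
   uniform. *)
apply: (@le_trans _ _ (expect B (best (opt_steps k) a))); last exact: maxB.
apply: le_expect => [|x xb]; first exact: red_ge0 bestk.
by apply: BP => ux; apply: nx; exists (best (opt_steps k) a), x.
Qed.

(** * Contexts and the strategy that refutes PAST *)

Definition context (F : A -> A) :=
  forall a mu, red a mu -> red (F a) (push F mu).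

(** Each step from [a] can be copied inside [F], while [F a] may admit further steps. *)
Lemma opt_steps_context F k a : context F -> opt_steps k a <= opt_steps k (F a).
Proof.
move=> cF; elim: k a => //= k IH a; case: asboolP => [_|nnf].
  exact: (opt_steps_ge0 k.+1).
have [ab _] := bestP (opt_steps k) nnf.
apply: le_trans (opt_steps_red k (cF _ _ ab)); rewrite lerD2l expect_push.
by apply: le_expect => [|x _ /=]; [exact: red_ge0 ab|exact: IH].
Qed.

(** The hypothesis abstracts the term f(b, a, ...): it is a context [F] around [b] and also a
    context [G] around a spare copy of [a]. *)
Lemma duplicable_PAST_SAST :
  (forall a, exists2 F, context F &
     forall b, exists2 G, context G & G a = F b) ->
  PAST red -> SAST red.
Proof.
move=> dup past; apply: contrapT => /not_SAST_unbounded[a ub_a].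
have [F cF FP] := dup a.
have /choice[nx nxP] : forall b, exists mx : multidist R A * (R * A),
    unbounded b -> [/\ red b mx.1, mx.2 \in mx.1 & unbounded mx.2.2].
  move=> b; have [/unbounded_red[mu [x mux]]|nub] := pselect (unbounded b).
    by exists (mu, x).
  by exists (mset0, (0, b)).
pose t n := iter n (fun b => (nx b).2.2) a.
have ub n : unbounded (t n) by elim: n => //= n /nxP[].
pose mu n := (nx (t n)).1; pose p n := (nx (t n)).2.1.
(* [rem] deletes one occurrence, so further copies of the chosen pair count as leaving the path. *)
pose off n := rem (nx (t n)).2 (mu n).
have tmu n : red (t n) (mu n) by case: (nxP _ (ub n)).
have tin n : (nx (t n)).2 \in mu n by case: (nxP _ (ub n)).
have muE n : perm_eq (mu n) ((p n, t n.+1) :: off n).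
  by rewrite /= -surjective_pairing perm_to_rem.
have p01 n : 0 < p n <= 1 by have [+ _] := red_fdist (tmu n); apply; exact: tin.
have off0 n x : x \in off n -> 0 <= x.1 by move=> /mem_rem /(red_ge0 (tmu n)).
have off1 n : \sum_(x <- off n) x.1 = 1 - p n.
  have [_] := red_fdist (tmu n); rewrite (perm_big _ (muE n)) big_cons /= => <-.
  by rewrite addrC addrK.
(* Horizon [K n] lifts the greedy value of [a] above the inverse of the probability of leaving at n;
   for [p n = 1] that inverse is 0 by convention. *)
have /choice[K KP] : forall n, exists k,
    (\prod_(i < n) p i * (1 - p n))^-1 < opt_steps k a by move=> n; exact: ub_a.
(* [inl n] is the n-th point of the path; [inr (k, u)] plays greedily from u with
   horizon k. *)
pose tm (q : nat + nat * A) := match q with inl n => F (t n) | inr ku => ku.2 end.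
pose step (q : nat + nat * A) : seq (R * (nat + nat * A)) := match q with
  | inl n => (p n, inl n.+1) :: [seq (x.1, inr (K n, F x.2)) | x <- off n]
  | inr (k, u) => if `[< normal_form red u >] then [:: (1, inr (k, u))] else
      [seq (x.1, inr (k.-1, x.2)) | x <- best (opt_steps k.-1) u]
  end.
have stepP q : mlift red (mdirac R (tm q)) (push tm (step q)).
  case: q => [n|[k u]] /=.
    apply: mlift_red; suff -> : push tm (step (inl n)) = push F (mu n).
      exact: cF.
    apply/eq_seq_msetP; rewrite perm_sym (perm_trans (perm_map _ (muE n))) //=.
    by rewrite -map_comp.
  case: asboolP => [nf|nnf]; first by rewrite push1; exact: mlift_nf.
  apply: mlift_red; have [+ _] := bestP (opt_steps k.-1) nnf.
  rewrite /push -map_comp /=.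
  by under eq_map do rewrite /= -surjective_pairing; rewrite map_id seq_mset_id.
pose L := steps_from tm step.
have L0 n q : 0 <= L n q by exact: steps_from_ge0 stepP n q.
have L_opt k u : opt_steps k u <= L k (inr (k, u)).
  elim: k u => [|k IH] u; first exact: L0.
  rewrite [L _ _]/= /live; case: asboolP => [nf|nnf] /=.
    case: asboolP => // _; rewrite add0r.
    by rewrite /expect big_seq1 mul1r; exact: L0.
  case: asboolP => // _; rewrite lerD2l /expect big_map /=.
  have [ubest _] := bestP (opt_steps k) nnf.
  rewrite !big_seq; apply: ler_sum => x xb.
  by rewrite ler_wpM2l ?(red_ge0 ubest).
have [B LB] := PAST_policy_bounded stepP (inl 0%N) past.
suff [n] : exists n, B < L n (inl 0%N) by rewrite ltNge LB.
apply: (@escape_recursion_unbounded R p (fun m => opt_steps (K m) a) K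
         (fun n m => L n (inl m))) => // [m n Kn|m pm].
  rewrite [leRHS]/= (live_red (cF _ _ (tmu m))) lerD2l /expect big_cons /=.
  rewrite lerD2l big_map -off1 mulr_suml !big_seq; apply: ler_sum => x xo.
  (* The element [F x.2] reached on leaving equals [G a], so its greedy value is at least that of
     [a]. *)
  rewrite ler_wpM2l ?(off0 _ _ xo) //=; have [G cG <-] := FP x.2.
  apply: le_trans (opt_steps_context (K m) a cG) (le_trans (L_opt _ _) _).
  exact: steps_from_homo.
have wp : 0 < \prod_(i < m) p i * (1 - p m).
  by rewrite mulr_gt0 ?subr_gt0 // prodr_gt0 // => i _; case/andP: (p01 i).
by rewrite mulrA mulrC -ler_pdivrMr // mul1r ltW.
Qed.

End FiniteBranching.
End Derivations.

(** * Finite branching and contexts for term rewriting *)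

Section TermRewriting.
Variables (R : realType) (S : signature) (V : countType).
Implicit Types (t u v : term S V) (s : V -> term S V).

Lemma subterm_at_nil t : subterm_at t [::] = Some t.
Proof. by case: t. Qed.

Lemma subst_eq_vars s s' t : subst s t = subst s' t ->
  forall x, vars t x -> s x = s' x.
Proof.
elim: t => [y sE x /= -> //|f a IH sE x [i _ ix]]; apply: IH ix.
(* [subterm_at] extracts an argument without inverting an equality of [App] terms, whose argument
   families have a type depending on [f]. *)
have := congr1 (fun u => subterm_at u [:: val i]) sE => /=.
by rewrite valK !subterm_at_nil => -[].
Qed.

Lemma eq_subst s s' t : (forall x, vars t x -> s x = s' x) ->
  subst s t = subst s' t.
Proof.
elim: t => [y|f a IH] ss' /=; first exact: ss'.
by congr App; apply/funext => i; apply: IH => x ix; apply: ss'; exists i.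
Qed.

Lemma finite_positions t : finite_set [set pi | subterm_at t pi <> None].
Proof.
elim: t => [x|f a IH].
  by apply: (sub_finite_set _ (finite_set1 [::])) => -[|i pi].
apply: (@sub_finite_set _ _ ([set [::]] `|` \bigcup_(i in [set: 'I_(arity f)])
    cons (val i) @` [set pi | subterm_at (a i) pi <> None])).
  move=> [|i pi] /=; first by left.
  case: insubP => [j _ <-|//] apij; right; exists j => //.
  by exists pi.
rewrite finite_setU; split; first exact: finite_set1.
by apply: bigcup_finite => // i _; exact/finite_image/IH.
Qed.

Lemma finite_subsingleton (T : Type) (D : set T) :
  (forall x y, D x -> D y -> x = y) -> finite_set D.
Proof.
move=> D1; have [[x Dx]|nD] := pselect (exists x, D x).
  by apply: (sub_finite_set _ (finite_set1 x)) => y Dy; exact: D1.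
by apply: (sub_finite_set _ (finite_set0 T)) => x Dx; apply: nD; exists x.
Qed.

(* A rule and a position determine the reduct, because the matching substitution
   is unique on the variables of the left-hand side. *)
Lemma finite_rewrite_full (P : ptrs R S V) t : finite_set (rules P) ->
  finite_set (rewrite_full P t).
Proof.
move=> finP; pose reducts (r : rule R S V) pi : set (multidist R (term S V)) :=
  [set nu | exists2 s, subterm_at t pi = Some (subst s r.1) &
    nu = mset_map (fun x : R * term S V => (x.1, replace_at t pi (subst s x.2))) r.2].
apply: (@sub_finite_set _ _ (\bigcup_(r in rules P)
    \bigcup_(pi in [set pi | subterm_at t pi <> None]) reducts r pi)).
  move=> nu [r [pi [s [Pr tpi ->]]]]; exists r => //.
  by exists pi; rewrite /= ?tpi //; exists s.
apply: bigcup_finite => // r Pr; apply: bigcup_finite => [|pi _].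
  exact: finite_positions.
apply: finite_subsingleton => _ _ [s tpi ->] [s' + ->].
rewrite tpi => -[/subst_eq_vars ss']; rewrite /mset_map; congr seq_mset.
apply/eq_in_map => x xr; congr (_, replace_at _ _ _); apply: eq_subst => y xy.
by have [_ _ /(_ x xr y xy)] := rules_wf Pr; exact: ss'.
Qed.

Definition plug (f : symbol S) (a : 'I_(arity f) -> term S V) (i : nat) u :=
  App f (fun j => if val j == i then u else a j).

(** A redex at [pi] in [u] becomes a redex at [i :: pi], with the same rule and substitution. *)
Lemma context_plug (P : ptrs R S V) f (a : 'I_(arity f) -> term S V) i :
  (i < arity f)%N -> context (rewrite_full P) (plug a i).
Proof.
move=> lti u _ [r [pi [s [Pr upi ->]]]]; exists r, (i :: pi), s; split=> //.
  by rewrite /= insubT /= eqxx.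
rewrite /mset_map push_seq_mset /push -map_comp; congr seq_mset.
apply/eq_map => x; rewrite /= /plug; congr (_, App _ _); apply/funext => j.
by case: eqP.
Qed.

(** Both contexts yield f(u, t, ..., t): the hole is argument 0 for [F] and argument 1 for [G],
    which needs arity at least 2. *)
Lemma rewrite_full_duplicable (P : ptrs R S V) t :
  (exists f : symbol S, (2 <= arity f)%N) ->
  exists2 F, context (rewrite_full P) F &
    forall u, exists2 G, context (rewrite_full P) G & G t = F u.
Proof.
move=> [f f2]; exists (plug (fun _ : 'I_(arity f) => t) 0).
  by apply: context_plug; apply: ltn_trans f2.
move=> u; exists (plug (fun j : 'I_(arity f) => if val j == 0%N then u else t) 1).
  exact: context_plug.
by rewrite /plug; congr App; apply/funext => j; case: eqP => [->|].
Qed.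

End TermRewriting.

Theorem theorem3p21 (R : realType) (S : signature) (V : countType)
    (P : ptrs R S V) (finP : finite_set (rules P))
    (binS : exists f : symbol S, (2 <= arity f)%N) :
  PAST (rewrite_full P) <-> SAST (rewrite_full P).
Proof.
split=> [|sast t mu tmu].
  apply: duplicable_PAST_SAST => t *.
  - exact: (@rewrite_full_fdist _ _ _ P t).
  - exact: finite_rewrite_full.
  - exact: rewrite_full_duplicable.
by apply: le_lt_trans (sast t); apply: ereal_sup_ubound; exists mu.
Qed.
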